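(* $\mathrm{sc}(\{f\in\mathbb{R}^{\mathbb{R}} : f \text{ is Darboux}\})=(2^{\omega})^{+}$.
   Context: $\mathbb{R}^{\mathbb{R}}$ is the set of all functions $f:\mathbb{R}\to\mathbb{R}$, and $\kappa^+$ is the successor cardinal of $\kappa$. A function $f:\mathbb{R}\to\mathbb{R}$ is Darboux if it has the intermediate value property, i.e. the image of every interval is an interval (possibly degenerate). A difference operator is a map $D:\mathbb{R}^{\mathbb{R}}\to\mathbb{R}^{\mathbb{R}}$ of the form $(Df)(x)=\sum_{i=1}^n a_i f(x+b_i)$ with $a_i,b_i\in\mathbb{R}$; $\mathcal{D}$ is the set of difference operators. A system of difference equations is a set $S\subset\mathcal{D}\times\mathbb{R}^{\mathbb{R}}$; a function $f:\mathbb{R}\to\mathbb{R}$ is a solution to $S$ if $Df=g$ for every $(D,g)\in S$. A subsystem of $S$ is a subset of $S$. For $\mathcal{F}\subset\mathbb{R}^{\mathbb{R}}$ the solvability cardinal $\mathrm{sc}(\mathcal{F})$ is the minimal cardinal $\kappa$ with the following property: for every system $S$ of difference equations, if every subsystem of $S$ of cardinality less than $\kappa$ has a solution in $\mathcal{F}$, then $S$ has a solution in $\mathcal{F}$. *)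

(* Defs.v *)
From HB Require Import structures.
From mathcomp Require Import all_boot all_order all_algebra.
From mathcomp Require Import boolp classical_sets functions cardinality reals.
From mathcomp Require Import num_normedtype.

Set Implicit Arguments.
Unset Strict Implicit.
Unset Printing Implicit Defensive.

Import Order.TTheory GRing.Theory Num.Theory.

Local Open Scope classical_set_scope.
Local Open Scope card_scope.
Local Open Scope ring_scope.

(* A cardinal is represented by a set, over any type, having that cardinality;
   cardinals are compared with [#<=], so a set represents a given cardinal
   exactly up to [#=]. *)

Definition card_lt (T U : Type) (A : set T) (B : set U) : Prop :=
  A #<= B /\ ~ (B #<= A).

Definition is_least_cardinal (P : forall U : Type, set U -> Prop)
    (T : Type) (K : set T) : Prop :=
  P T K /\ forall (U : Type) (L : set U), P U L -> K #<= L.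

Definition is_successor_cardinal (T : Type) (A : set T)
    (U : Type) (K : set U) : Prop :=
  is_least_cardinal (fun V (L : set V) => card_lt A L) K.

(* 2 ^ omega *)
Definition continuum : set (nat -> bool) := [set: nat -> bool].

Section DifferenceEquations.
Variable R : realType.

Definition is_darboux (f : R -> R) : Prop :=
  forall I : set R, is_interval I -> is_interval (f @` I).

Definition is_difference_operator (D : (R -> R) -> (R -> R)) : Prop :=
  exists (n : nat) (a b : 'I_n -> R),
    forall (f : R -> R) (x : R), D f x = \sum_(i < n) a i * f (x + b i).

Definition equation : Type := (((R -> R) -> (R -> R)) * (R -> R))%type.

Definition is_system (S : set equation) : Prop :=
  forall e, S e -> is_difference_operator e.1.

Definition is_solution (S : set equation) (f : R -> R) : Prop :=
  forall e, S e -> e.1 f = e.2.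

Definition solvable_in (F : set (R -> R)) (S : set equation) : Prop :=
  exists2 f : R -> R, F f & is_solution S f.

Definition has_sc_property (F : set (R -> R)) (T : Type) (K : set T) : Prop :=
  forall S : set equation, is_system S ->
    (forall S' : set equation,
       S' `<=` S -> card_lt S' K -> solvable_in F S') ->
    solvable_in F S.

Definition is_solvability_cardinal (F : set (R -> R))
    (T : Type) (K : set T) : Prop :=
  is_least_cardinal (has_sc_property F) K.

End DifferenceEquations.

(* Main.v *)
Require Import Defs.
From HB Require Import structures.
From mathcomp Require Import all_boot all_order all_algebra.
From mathcomp Require Import boolp classical_sets functions cardinality reals.
From mathcomp Require Import wochoice num_normedtype ring lra.

(** Write c for the cardinality of the continuum. The successor of c has the
    compactness property for any class of functions whatsoever: a difference
    operator is determined by a finite list of reals, so there are only c of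
    them, and as soon as all two-element subsystems of a system are solvable
    each operator occurs with only one right-hand side. The system then has at
    most c equations and is one of its own small subsystems
    ([sc_property_above_continuum]).

    For the other inequality, let [spike] be the indicator function of 0 and
    consider equations saying that F and [spike] have the same increments with
    step h. If h runs over a generating set of the additive group R, then a
    solution is [spike] plus a constant; it takes exactly two values and is not
    Darboux. If all the steps used lie in a dense subgroup V having c cosets,
    then one may add to [spike] any V-periodic function, for instance one whose
    constant values on the cosets of V exhaust R. The cosets are dense and
    [spike] affects a single point, so the sum takes every value on every open
    interval, hence is Darboux ([spike_plus_periodic_darboux]).

    So there must be steps h, generating R, such that any fewer than c of them
    lie in one such V. They are obtained from a direct sum decomposition of R
    as a rational vector space, R = W + sum of V_x with x in 2^omega, where
    V_x is spanned by c members of an explicit independent family. Let G_x be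
    the sum of all summands except V_x, and use as steps the reals that lie in
    G_x for all x but at most one. Fewer than c equations have fewer than c
    exceptional indices, so some G_x contains all their steps
    ([separating_subspaces], [no_sc_property_below_continuum]). The family,
    indexed by pairs (x, y) in 2^omega x 2^omega, consists of the sums of 1/n!
    over the members of an almost disjoint family of sets of integers
    ([fact_independent_family]). *)

Set Implicit Arguments.
Unset Strict Implicit.
Unset Printing Implicit Defensive.

Import Order.TTheory GRing.Theory Num.Theory.

Local Open Scope classical_set_scope.
Local Open Scope card_scope.
Local Open Scope ring_scope.

(** * Cardinal comparison and successor cardinals *)

Lemma inj_on_card_le (T U : Type) (A : set T) (B : set U) (f : T -> U) :
  (forall x, A x -> B (f x)) ->
  (forall x y, A x -> A y -> f x = f y -> x = y) -> A #<= B.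
Proof.
move=> fAB finj; apply: (@card_le_trans _ _ _ (f @` A)).
  have /card_eqPle[_ h] : f @` A #= A; last by [].
  by apply: inj_card_eq => x y /set_mem Ax /set_mem Ay; exact: finj.
by apply: subset_card_le => _ [x Ax <-]; exact: fAB.
Qed.

Lemma Cantor (U : Type) (A : set U) : ~ ([set: set U] #<= A).
Proof.
move=> /pfcard_geP[e|[g]].
  by have : @set0 (set U) set0 by rewrite -e.
have [u Au gu] := @surj _ _ _ _ g [set u | ~ g u u] I.
have D : g u u <-> ~ g u u by rewrite {1}gu.
have nguu : ~ g u u := fun h => D.1 h h.
exact: nguu (D.2 nguu).
Qed.

Lemma well_order_minimum (T : eqType) (r : rel T) (P : T -> Prop) :
  well_order r -> (exists x, P x) ->
  exists x, P x /\ forall y, P y -> r x y.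
Proof.
move=> rwo [x Px]; have [|z [[Pz zmin] _]] := rwo [pred y | `[< P y >]].
  by exists x; apply/asboolP.
exists z; split; first exact/asboolP.
by move=> y Py; apply: zmin; apply/asboolP.
Qed.

Definition below (T : eqType) (r : rel T) (x : T) : set T :=
  [set y | r y x && (y != x)].

Lemma well_order_below_wf (T : eqType) (r : rel T) :
  well_order r -> well_founded (fun y x => below r x y).
Proof.
move=> rwo x; apply: contrapT => nx.
have [z [nz zmin]] := @well_order_minimum _ r (fun x => ~ Acc _ x) rwo
  (ex_intro _ x nx).
apply: nz; constructor => y /andP[ryz yz]; apply: contrapT => ny.
have [_ anti] : reflexive r /\ antisymmetric r.
  have w : @wo_chain T r predT by apply: withinW.
  by split=> [t|s t]; [exact: (wo_chain_reflexive w)|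
                       exact: (wo_chain_antisymmetric w)].
by case/negP: yz; apply/eqP/anti; rewrite ryz zmin.
Qed.

(** Transfinite recursion along [r] sends each x in K to an element of L not
    taken before. Either this never fails and the resulting map is injective on
    K, or at some x the values taken before x already exhaust L. *)
Lemma well_order_comparison (T : eqType) (r : rel T) (K : set T)
    (U : Type) (L : set U) : well_order r ->
  K #<= L \/ exists2 x, K x & L #<= K `&` below r x.
Proof.
move=> rwo; have wf := well_order_below_wf rwo.
have anti_tot x y : x != y -> below r x y \/ below r y x.
  move=> xy; have w : @wo_chain T r predT by apply: withinW.
  have /orP[rxy|ryx] := wo_chainW w (erefl : x \in predT) (erefl : y \in predT).
    by right; apply/andP.
  by left; apply/andP; rewrite eq_sym.
have [[u0 Lu0]|L0] := pselect (exists u, L u); last first.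
  have -> : L = set0 by apply/seteqP; split=> u // Lu; apply: L0; exists u.
  have [[x Kx]|K0] := pselect (exists x, K x).
    by right; exists x => //; exact: card_ge0.
  by left; have -> : K = set0 by apply/seteqP; split=> x // Kx; apply: K0; exists x.
(* A choice function on subsets of U, with the junk value u0 on the empty set. *)
pose pick (P : set U) :=
  if pselect (exists u, P u) is left ex then sval (cid ex) else u0.
have pickP (P : set U) : P !=set0 -> P (pick P).
  by rewrite /pick => ex; case: pselect => // ex'; case: cid.
pose step x (rec : forall y, below r x y -> U) : U :=
  pick [set u | L u /\ forall y (h : below r x y), K y -> rec y h <> u].
pose f := Fix wf (fun=> U) step.
have fE x : f x =
    pick [set u | L u /\ forall y, below r x y -> K y -> f y <> u].
  rewrite {1}/f Fix_eq // => {}x g h gh.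
  by congr (step x _); apply/functional_extensionality_dep => y;
     apply/functional_extensionality_dep.
pose free x := [set u | L u /\ forall y, below r x y -> K y -> f y <> u].
have [allfree|] := pselect (forall x, K x -> free x !=set0).
  left; have fP x : K x -> free x (f x).
    by move=> /allfree; rewrite fE; exact: pickP.
  apply: (@inj_on_card_le _ _ _ _ f) => [x /fP[]//|x y Kx Ky fxy].
  apply: contrapT => /eqP/anti_tot[yx|xy].
    by have [_ /(_ y yx Ky)] := fP x Kx; rewrite fxy.
  by have [_ /(_ x xy Kx)] := fP y Ky; rewrite fxy.
move=> /existsNP[x /not_implyP[Kx nfree]]; right; exists x => //.
apply: (@card_le_trans _ _ _ (f @` (K `&` below r x))); last exact: card_image_le.
apply: subset_card_le => u Lu; apply: contrapT => nu; apply: nfree; exists u.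
by split=> // y yx Ky fyu; apply: nu; exists y.
Qed.

(** In a well-ordering of the power set of U, take the shortest initial segment
    that does not embed in A, or the whole power set if there is none. The
    conclusion that K embeds in every L with L not below A is stronger than
    minimality among the L above A: it builds in the comparability of L with
    A. *)
Lemma successor_cardinal_exists (U : Type) (A : set U) :
  exists (T : Type) (K : set T), is_successor_cardinal A K /\
    forall (V : Type) (L : set V), ~ (L #<= A) -> K #<= L.
Proof.
pose T := {classic (set U)}; have [r rwo] := well_ordering_principle T.
have [K [nKA Kseg]] : exists K : set T, ~ (K #<= A) /\
    forall x, K x -> K `&` below r x #<= A.
  have [allle|] := pselect (forall x, below r x #<= A).
    exists setT; split; first exact: Cantor.
    by move=> x _; rewrite setTI.
  move=> /existsNP/(well_order_minimum rwo)[x [nx xmin]].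
  exists (below r x); split=> // y /andP[ryx yx].
  apply: (@card_le_trans _ _ _ (below r y)); first by apply: subset_card_le => z [].
  apply: contrapT => /xmin rxy; case/negP: yx; apply/eqP.
  apply: (@wo_chain_antisymmetric T r predT) => //; first exact: withinW.
  by rewrite ryx rxy.
have Kmin (V : Type) (L : set V) : ~ (L #<= A) -> K #<= L.
  move=> nLA; have [//|[x Kx Lx]] := well_order_comparison K L rwo.
  by case: nLA; apply: card_le_trans Lx (Kseg _ Kx).
exists T, K; split=> //; split; last by move=> V L [_]; exact: Kmin.
split=> //; have [/nKA[]|[x Kx Ax]] := well_order_comparison K A rwo.
by apply: card_le_trans Ax _; apply: subset_card_le => y [].
Qed.

(** * Reals with sparse factorial expansions *)

Section FactorialExpansions.
Variable R : realType.
Implicit Types (e : nat -> int) (r : R).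

Definition fact_sum e N : R := \sum_(n < N) (e n)%:~R / n`!%:R.

(** The error bound of order 1/N! makes this relation additive in e and r and
    still leaves an error of order 1/N after multiplication by the common
    denominator (N-1)! of the partial sum. *)
Definition fact_expansion e r :=
  exists C : R, forall N, `|r - fact_sum e N.+1| <= C / N.+1`!%:R.

Lemma fact_sumS e N : fact_sum e N.+1 = fact_sum e N + (e N)%:~R / N`!%:R.
Proof. by rewrite /fact_sum big_ord_recr. Qed.

Lemma factr_gt0 n : 0 < n`!%:R :> R.
Proof. by rewrite ltr0n fact_gt0. Qed.

Lemma fact_sum_int e N : N`!%:R * fact_sum e N.+1 \is a Num.int.
Proof.
elim: N => [|N IH].
  by rewrite fact0 mul1r /fact_sum big_ord1 fact0 divr1 intr_int.
rewrite fact_sumS mulrDr mulrCA divff ?gt_eqF ?factr_gt0 // mulr1.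
by rewrite factS natrM -mulrA rpredD ?intr_int // rpredM // natr_int.
Qed.

Lemma fact_expansionB e1 e2 r1 r2 : fact_expansion e1 r1 ->
  fact_expansion e2 r2 -> fact_expansion (fun n => e1 n - e2 n) (r1 - r2).
Proof.
move=> [C1 h1] [C2 h2]; exists (C1 + C2) => N.
have -> : fact_sum (fun n => e1 n - e2 n) N.+1 =
    fact_sum e1 N.+1 - fact_sum e2 N.+1.
  by rewrite /fact_sum -sumrB; apply: eq_bigr => i _; rewrite rmorphB mulrBl.
rewrite mulrDl (_ : _ - _ - _ = (r1 - fact_sum e1 N.+1) - (r2 - fact_sum e2 N.+1)).
  by rewrite (le_trans (ler_normB _ _)) // lerD.
by ring.
Qed.

Lemma fact_expansionZ (k : int) e r : fact_expansion e r ->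
  fact_expansion (fun n => k * e n) (k%:~R * r).
Proof.
move=> [C h]; exists (`|k%:~R| * C) => N.
have -> : fact_sum (fun n => k * e n) N.+1 = k%:~R * fact_sum e N.+1.
  by rewrite /fact_sum mulr_sumr; apply: eq_bigr => i _; rewrite rmorphM mulrA.
by rewrite -mulrBr normrM -mulrA ler_wpM2l.
Qed.

(** Multiplied by m!, the partial sum up to the index m is an integer; for an
    expansion of 0 its absolute value is at most C / (m + 1). Hence the partial
    sums, and then the digits, vanish from some index on. *)
Lemma fact_expansion0 e : fact_expansion e 0 ->
  exists M, forall n, (M <= n)%N -> e n = 0.
Proof.
move=> [C h].
have small m : C < m.+1%:R -> fact_sum e m.+1 = 0.
  move=> Cm; have := h m; rewrite sub0r normrN => {}h.
  apply: contraTeq Cm => s0; rewrite -leNgt.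
  have f0 : m`!%:R != 0 :> R by rewrite gt_eqF ?factr_gt0.
  have := norm_intr_ge1 (fact_sum_int e m) (mulf_neq0 f0 s0).
  rewrite normrM (ger0_norm (ltW (factr_gt0 m))) => ge1.
  move: h; rewrite ler_pdivlMr ?factr_gt0 // factS natrM => h.
  apply: le_trans h.
  by rewrite mulrCA ler_peMr ?ler0n // mulrC.
exists (Num.bound C).+1 => -[//|n] Mn.
have lt k : (Num.bound C <= k)%N -> C < k.+1%:R.
  by move=> bk; rewrite (lt_trans (unstable.ltr_bound C))// ltr_nat.
have /eqP := small _ (lt _ (ltnW Mn)); rewrite fact_sumS small ?lt // add0r.
rewrite mulf_eq0 invr_eq0 [_ == 0 in X in _ || X]gt_eqF ?factr_gt0 // orbF.
by rewrite intr_eq0 => /eqP.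
Qed.

Lemma fact_expansion_exists (A : nat -> bool) :
  exists r, fact_expansion (fun n => (A n : nat)%:Z) r.
Proof.
set e := (fun n => (A n : nat)%:Z); set s := fact_sum e.
have term N : 0 <= ((e N)%:~R / N`!%:R : R) <= 1 / N`!%:R.
  rewrite divr_ge0 ?ler0z ?ler0n //= ler_pM2r ?invr_gt0 ?factr_gt0 //.
  by rewrite /e; case: (A N).
have mono N k : s N <= s (N + k)%N.
  elim: k => [|k IH]; first by rewrite addn0.
  rewrite (le_trans IH) // addnS /s fact_sumS lerDl.
  by have /andP[] := term (N + k)%N.
(* The upper bounds s M + 2 / M! decrease, because 2 / (M + 1) <= 1 for M >= 1. *)
have tail N k : s (N.+1 + k)%N + 2 / (N.+1 + k)`!%:R <= s N.+1 + 2 / N.+1`!%:R.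
  elim: k => [|k IH]; first by rewrite addn0.
  apply: le_trans IH; rewrite addnS /s fact_sumS -addrA lerD2l.
  set M := (N.+1 + k)%N; have /andP[_ le1] := term M.
  have : 2 / M.+1`!%:R <= 1 / M`!%:R :> R.
    rewrite factS natrM invfM mulrA ler_pM2r ?invr_gt0 ?factr_gt0 //.
    by rewrite ler_pdivrMr ?ltr0n // mul1r ler_nat /M addSn.
  move: le1; lra.
have up N k : s k <= s N.+1 + 2 / N.+1`!%:R.
  have := mono k N.+1; rewrite addnC => /le_trans; apply.
  apply: le_trans (tail N k); rewrite lerDl divr_ge0 //.
pose E : set R := range s.
have ubE : has_ubound E by exists (s 1%N + 2 / 1`!%:R) => _ [k _ <-]; exact: up.
exists (sup E); exists 2 => N; rewrite ger0_norm.
  rewrite lerBlDl; apply: ge_sup; first by exists (s 0%N), 0%N.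
  by move=> _ [k _ <-]; exact: up.
by rewrite subr_ge0; apply: ub_le_sup => //; exists N.+1.
Qed.

End FactorialExpansions.

(** * An almost disjoint family of sets of integers *)

Section AlmostDisjoint.

Definition cantor2 : Type := ((nat -> bool) * (nat -> bool))%type.

Definition code (p : cantor2) (k : nat) : nat :=
  pickle (mkseq (fun i => (p.1 i, p.2 i)) k).

Definition codes (p : cantor2) (n : nat) : bool := `[< exists k, code p k = n >].

Lemma codes_code p k : codes p (code p k).
Proof. by apply/asboolP; exists k. Qed.

Lemma code_unbounded p M K : exists2 k, (K <= k)%N & (M <= code p k)%N.
Proof.
apply: contrapT => bounded.
have inj : injective (code p).
  by move=> k l /(pcan_inj pickleK)/(congr1 size); rewrite !size_mkseq.
have := @uniq_leq_size _ [seq code p k | k <- iota K M.+1] (iota 0 M).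
rewrite map_inj_uniq // iota_uniq size_map !size_iota ltnn => h.
suff: false by []; apply: h => // _ /mapP[k kK ->].
rewrite mem_iota leq0n add0n ltnNge; apply/negP => Mk.
by apply: bounded; exists k => //; move: kK; rewrite mem_iota => /andP[].
Qed.

(** If p and u differ at i, no finite segment of u longer than i is a segment
    of p. *)
Lemma codes_almost_disjoint p u : p <> u ->
  exists K, forall k, (K <= k)%N -> codes p (code u k) = false.
Proof.
move=> pu.
have [i pui] : exists i, (p.1 i, p.2 i) <> (u.1 i, u.2 i).
  apply: contrapT => /forallNP eq_pu; apply: pu.
  case: p u eq_pu => [p1 p2] [u1 u2] eq_pu.
  by congr pair; apply/funext => i; have /contrapT[] := eq_pu i.
exists i.+1 => k ik; apply/negP => /asboolP[l].
move=> /(pcan_inj pickleK) eqs; apply: pui.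
have kl : l = k by have := congr1 size eqs; rewrite !size_mkseq.
have := congr1 (fun s => nth (false, false) s i) eqs.
by rewrite kl !nth_mkseq.
Qed.

End AlmostDisjoint.

(** * Rational subspaces of the reals *)

Section Subspaces.
Variable R : realType.
Implicit Types (V W L A : set R) (x y z : R).

Definition sub_closed V := forall x y, V x -> V y -> V (x - y).

(** Rational subspaces, encoded without rational scalars. The empty set is
    admitted, so that the union of an empty chain qualifies when a maximal
    subspace is sought. *)
Definition qsubspace V :=
  sub_closed V /\ forall x n, V x -> V (x / n.+1%:R).

Lemma sub_closed_ops V v : sub_closed V -> V v ->
  [/\ V 0, forall x, V x -> V (- x), forall x y, V x -> V y -> V (x + y) &
      forall x (k : int), V x -> V (x *~ k)].
Proof.
move=> VB Vv; have V0 : V 0 by rewrite -(subrr v); exact: VB.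
have VN x : V x -> V (- x) by rewrite -sub0r; exact: VB.
have VD x y : V x -> V y -> V (x + y).
  by move=> Vx Vy; rewrite -(opprK y); apply: VB => //; exact: VN.
split=> // x k Vx; have Vn n : V (x *+ n).
  by elim: n => [|n IH]; rewrite ?mulr0n // mulrS; exact: VD.
by case: k => n; [exact: Vn | apply: VN; exact: Vn].
Qed.

(** A nonzero vector can be divided until it is shorter than the interval, and
    then some integer multiple of it falls inside. *)
Lemma qsubspace_dense V g a b : qsubspace V -> V g -> g != 0 -> a < b ->
  exists2 z, V z & a < z < b.
Proof.
move=> [VB Vdiv] Vg g0 ab.
have [V0 VN VD Vz] := sub_closed_ops VB Vg.
have [h h0 Vh] : exists2 h, 0 < h & V h.
  have [g_gt0|g_lt0|g_eq0] := ltrgt0P g; [by exists g| |by rewrite g_eq0 eqxx in g0].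
  by exists (- g); [rewrite oppr_gt0|exact: VN].
pose n := Num.bound (h / (b - a)).
pose d := h / n.+1%:R.
have d0 : 0 < d by rewrite divr_gt0.
have dab : d < b - a.
  rewrite /d ltr_pdivrMr // mulrC -ltr_pdivrMr ?subr_gt0 //.
  by rewrite (lt_trans (unstable.ltr_bound _)) // ltr_nat.
exists (d *~ (Num.floor (a / d) + 1)); first exact/Vz/Vdiv.
rewrite -mulrzr; set k := Num.floor (a / d).
have /andP[kle klt] := floor_itv (a / d).
rewrite mulrC -ltr_pdivrMr // klt /=.
move: kle; rewrite ler_pdivlMr // intrD mulrDl mul1r -/k; lra.
Qed.

Definition qspan A := [set z | forall V, qsubspace V -> A `<=` V -> V z].

Lemma qspan_sub A : A `<=` qspan A.
Proof. by move=> z Az V _; exact. Qed.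

Lemma qspan_min A V : qsubspace V -> A `<=` V -> qspan A `<=` V.
Proof. by move=> qV AV z; apply. Qed.

Lemma qsubspace_qspan A : qsubspace (qspan A).
Proof.
split=> [x y Ax Ay|x n Ax] V qV AV.
  by apply: qV.1; [exact: Ax|exact: Ay].
by apply: qV.2; exact: Ax.
Qed.

Lemma qsubspace_addition V W : qsubspace V -> qsubspace W ->
  qsubspace [set z | exists v w, [/\ V v, W w & z = v + w]].
Proof.
move=> [VB Vdiv] [WB Wdiv]; split.
  move=> _ _ [v [w [Vv Ww ->]]] [v' [w' [Vv' Ww' ->]]].
  by exists (v - v'), (w - w'); split; [exact: VB|exact: WB|ring].
move=> _ n [v [w [Vv Ww ->]]]; exists (v / n.+1%:R), (w / n.+1%:R).
by split; [exact: Vdiv|exact: Wdiv|rewrite mulrDl].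
Qed.

(** A maximal W among the subspaces meeting L trivially is a complement: if r
    were outside W + L, the subspace spanned by W and r would still meet L
    trivially. *)
Lemma qsubspace_complement L : qsubspace L -> L 0 -> exists W,
  [/\ qsubspace W, W 0, (forall z, W z -> L z -> z = 0) &
      forall r, exists w l, [/\ W w, L l & r = w + l]].
Proof.
move=> qL L0.
pose P : set (set R) := [set W | qsubspace W /\ forall z, W z -> L z -> z = 0].
have [|W [[qW WL] Wmax]] := @Zorn_bigcup _ P.
  move=> F FP Ftot; split; last by move=> z [X /FP[_ XL] /XL].
  split; last by move=> x n [X FX Xx]; exists X => //; apply: (FP _ FX).1.2.
  move=> x y [X FX Xx] [Y FY Yy]; have [XY|YX] := Ftot _ _ FX FY.
    by exists Y => //; apply: (FP _ FY).1.1 => //; exact: XY.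
  by exists X => //; apply: (FP _ FX).1.1 => //; exact: YX.
have W0 : W 0.
  apply: contrapT => nW0; apply: (Wmax [set 0]).
    split; last by move=> /(_ 0 erefl).
    move=> w Ww; case: nW0; rewrite -(subrr w); exact: qW.1.
  split; last by move=> z ->.
  by split=> [x y -> ->|x n ->]; rewrite /= ?subrr ?mul0r.
exists W; split=> // r.
have [_ WN WD WZ] := sub_closed_ops qW.1 W0.
have [_ LN LD LZ] := sub_closed_ops qL.1 L0.
apply: contrapT => nr.
(* The span of W and r, with rational coefficients cleared of denominators. *)
pose W' : set R := [set z | exists (n : nat) (m : int), W (z *+ n.+1 - r *~ m)].
have WW' : W `<=` W'.
  by move=> w Ww; exists 0%N, 0; rewrite mulr0z subr0 mulr1n.
have W'r : W' r by exists 0%N, 1; rewrite mulr1n mulr1z subrr.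
apply: (Wmax W').
  split=> // /(_ _ W'r) Wr; apply: nr; exists r, 0; split=> //.
  by rewrite addr0.
have prodE a b : ((a.+1 * b.+1).-1.+1 = a.+1 * b.+1)%N by rewrite prednK.
have transport a b : W a -> a = b -> W b by move=> ? <-.
split; first split.
- move=> x y [n [m Wx]] [n' [m' Wy]].
  exists (n.+1 * n'.+1).-1, (m * n'.+1%:Z - m' * n.+1%:Z).
  apply: (transport _ _ (qW.1 _ _ (WZ _ n'.+1%:Z Wx) (WZ _ n.+1%:Z Wy))).
  rewrite prodE -!(mulrzr (_ - _)) -!(mulrzr r) -!(mulr_natr x) -!(mulr_natr y).
  by rewrite -(mulr_natr (x - y)) natrM rmorphB !rmorphM /=; ring.
- move=> x k [n [m Wx]]; exists (k.+1 * n.+1).-1, m.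
  apply: (transport _ _ Wx); rewrite prodE.
  by rewrite mulrnA -[_ *+ k.+1]mulr_natr divfK ?pnatr_eq0.
- move=> z [n [m Wz]] Lz.
  have [m0|m0] := eqVneq m 0.
    move: Wz; rewrite m0 mulr0z subr0 => Wz.
    have /eqP := WL _ Wz (LZ _ n.+1%:Z Lz).
    by rewrite mulrn_eq0 => /eqP.
  case: nr.
  (* Here r *~ m lies in W + L and m is nonzero, so r itself lies in W + L. *)
  have cancel V x : qsubspace V -> V 0 -> V (x *~ m) -> V x.
    move=> qV V0 Vx; have [_ VN _ VZ] := sub_closed_ops qV.1 V0.
    case: m m0 Vx {Wz} => [[|k]|k] // _ Vx.
      have := qV.2 _ k Vx; rewrite -pmulrn -(mulr_natr x) mulfK //.
      by rewrite pnatr_eq0.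
    have := VN _ (qV.2 _ k Vx); rewrite NegzE mulrNz mulNr opprK.
    by rewrite -pmulrn -(mulr_natr x) mulfK // pnatr_eq0.
  apply: (cancel _ r (qsubspace_addition qW qL)); first by exists 0, 0; rewrite addr0.
  exists (- (z *+ n.+1 - r *~ m)), (z *+ n.+1); split; first exact: WN.
    exact: (LZ _ n.+1%:Z Lz).
  by rewrite opprB subrK.
Qed.

End Subspaces.

(** * Decomposition of the reals into a direct sum *)

Section Separation.
Variable R : realType.

(** The reals some multiple of which has an expansion with digits vanishing at
    almost all codes of u form a rational subspace. It contains X p for every
    p <> u by almost disjointness, but not X u: subtracting expansions would
    give one of 0 with infinitely many nonzero digits. *)
Lemma fact_independent_family : exists X : cantor2 -> R,
  forall u, ~ qspan (X @` [set p | p <> u]) (X u).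
Proof.
have [X XE] := choice (fun p : cantor2 => fact_expansion_exists R (codes p)).
exists X => u.
pose thin : set R := [set r | exists (d : nat) (e : nat -> int),
  fact_expansion e (d.+1%:Z%:~R * r) /\
  exists K, forall k, (K <= k)%N -> e (code u k) = 0].
have qthin : qsubspace thin.
  split.
    move=> x y [d [e [xe [K eK]]]] [d' [e' [ye [K' eK']]]].
    exists (d'.+1 * d.+1).-1, (fun n => d'.+1%:Z * e n - d.+1%:Z * e' n); split.
      have := fact_expansionB (fact_expansionZ d'.+1%:Z xe)
                              (fact_expansionZ d.+1%:Z ye).
      congr fact_expansion; rewrite prednK ?muln_gt0 // PoszM rmorphM /=; ring.
    exists (maxn K K') => k; rewrite geq_max => /andP[Kk Kk'].
    by rewrite eK // eK' // !mulr0 subrr.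
  move=> x n [d [e [xe eK]]]; exists (d.+1 * n.+1).-1, e; split=> //.
  move: xe; congr fact_expansion; rewrite prednK ?muln_gt0 // PoszM rmorphM /=.
  by rewrite -mulrA [n.+1%:~R * _]mulrC divfK // pnatr_eq0.
have thinX : X @` [set p | p <> u] `<=` thin.
  move=> _ [p pu <-]; exists 0%N, (fun n => (codes p n : nat)%:Z); split.
    by rewrite mul1r.
  have [K pK] := codes_almost_disjoint pu.
  by exists K => k /pK ->.
move=> /(_ _ qthin thinX)[d [e [Xe [K eK]]]].
have := fact_expansionB Xe (fact_expansionZ d.+1%:Z (XE u)).
rewrite subrr => /fact_expansion0[M zero].
have [k Kk Mk] := code_unbounded u M K.
by have := zero _ Mk; rewrite eK // codes_code.
Qed.

(** For the independent family X indexed by pairs (x, y), with L its span and W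
    a complement of L, the subspace G x is W plus the span of the X p whose
    first index is not x. The vectors v x y = X (x, y) lie in different cosets
    of G x. In the last clause the steps h lying in every G x' except perhaps
    G x include W and all rational multiples of members of X, so they generate
    R. *)
Lemma separating_subspaces :
  exists (G : (nat -> bool) -> set R) (v : (nat -> bool) -> (nat -> bool) -> R),
  [/\ forall x, qsubspace (G x),
      forall x, exists2 g, G x g & g != 0,
      forall x y y', G x (v x y - v x y') -> y = y' &
      forall V, sub_closed V ->
        (forall h x, (forall x', x' <> x -> G x' h) -> V h) -> forall r, V r].
Proof.
have [X Xind] := fact_independent_family.
have X0 u : X u != 0.
  apply/eqP => Xu0; apply: (Xind u); rewrite Xu0.
  pose p : cantor2 := (fun n => ~~ u.1 n, u.2).
  have Xp : (X @` [set p | p <> u]) (X p).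
    exists p => //= /(congr1 (fun q : cantor2 => q.1 0%N)) /=.
    by case: (u.1 0%N).
  by rewrite -(subrr (X p)); apply: (qsubspace_qspan _).1; exact: qspan_sub.
have span0 A x : A x -> @qspan R A 0.
  by move=> Ax; rewrite -(subrr x); apply: (qsubspace_qspan _).1; exact: qspan_sub.
pose L := qspan (range X).
have L0 : L 0 by apply: (span0 _ (X (xpredT, xpredT))); exists (xpredT, xpredT).
have [W [qW W0 WL0 WL]] := qsubspace_complement (qsubspace_qspan (range X)) L0.
pose J x := X @` [set p : cantor2 | p.1 <> x].
pose G x : set R := [set z | exists w l, [/\ W w, qspan (J x) l & z = w + l]].
have JL x : qspan (J x) `<=` L.
  apply: qspan_min; first exact: qsubspace_qspan.
  by move=> _ [p _ <-]; apply: qspan_sub; exists p.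
have JX p x : p.1 <> x -> G x (X p).
  move=> px; exists 0, (X p); rewrite add0r; split=> //.
  by apply: qspan_sub; exists p.
have neg x : (fun n : nat => ~~ x n) <> x.
  by move=> /(congr1 (fun f => f 0%N)); case: (x 0%N).
have J0 x : qspan (J x) 0.
  by apply: (span0 _ (X (fun n => ~~ x n, x))); exists (fun n => ~~ x n, x) => //=.
have qG x : qsubspace (G x).
  by apply: qsubspace_addition => //; exact: qsubspace_qspan.
exists G, (fun x y => X (x, y)); split=> //.
- by move=> x; exists (X (fun n => ~~ x n, x)) => //; apply: JX => /=.
- move=> x y y' [w [l [Ww Jl e]]]; apply: contrapT => yy'.
  have LB := (qsubspace_qspan (range X)).1.
  have LX p : L (X p) by apply: qspan_sub; exists p.
  have w0 : w = 0.
    apply: WL0 => //; rewrite (_ : w = (X (x, y) - X (x, y')) - l).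
      by apply: (LB _ _ (LB _ _ (LX _) (LX _))); exact: JL Jl.
    by rewrite e addrK.
  apply: (Xind (x, y)).
  have -> : X (x, y) = X (x, y') - (0 - l).
    by rewrite sub0r opprK addrC -[l]add0r -w0 -e subrK.
  have sB := (qsubspace_qspan (X @` [set p | p <> (x, y)])).1.
  have sX p : p <> (x, y) -> qspan (X @` [set p | p <> (x, y)]) (X p).
    by move=> pxy; apply: qspan_sub; exists p.
  have sJ : qspan (J x) `<=` qspan (X @` [set p | p <> (x, y)]).
    apply: qspan_min; first exact: qsubspace_qspan.
    by move=> _ [p /= px <-]; apply: sX => pxy; apply: px; rewrite pxy.
  apply: (sB _ _ (sX _ _)); first by case=> /esym.
  by apply: (sB _ _ _ (sJ _ Jl)); apply: sJ; exact: J0.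
- move=> V VB Vgen.
  (* V need not be divisible, but V' is, and it contains the same steps h. *)
  pose V' : set R := [set z | forall n, V (z / n.+1%:R)].
  have qV' : qsubspace V'.
    split=> [y z Vy Vz n|y n Vy m]; first by rewrite mulrBl; exact: VB.
    have := Vy (n.+1 * m.+1).-1; rewrite prednK ?muln_gt0 //.
    by rewrite natrM invfM mulrA.
  have V'gen h x : (forall x', x' <> x -> G x' h) -> V' h.
    by move=> hx n; apply: (Vgen _ x) => x' /hx; exact: (qG x').2.
  move=> r; suff: V' r by move=> /(_ 0%N); rewrite divr1.
  have [w [l [Ww Ll ->]]] := WL r.
  have V'w : V' w.
    by apply: (V'gen _ xpredT) => x' _; exists w, 0; rewrite addr0.
  have V'l : V' l.
    apply: Ll => // _ [p _ <-].
    by apply: (V'gen _ p.1) => x' px'; apply: JX => /esym.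
  by have [_ _ V'D _] := sub_closed_ops qV'.1 V'w; exact: V'D.
Qed.

End Separation.

(** * Counting difference operators *)

Section UpperBound.
Variable R : realType.

Definition cut (r : R) (q : rat) : bool := ratr q < r.

Lemma cut_inj (r s : R) : cut r =1 cut s -> r = s.
Proof.
have lt (x y : R) : x < y -> ~ cut x =1 cut y.
  move=> /rat_in_itvoo[q]; rewrite in_itv /= => /andP[xq qy] /(_ q).
  by rewrite /cut qy (lt_gtF xq).
move=> e; have [/lt[]|/lt[]|//] := ltrgtP r s => //.
Qed.

(** A finite list of pairs of reals as one subset of a countable set: the
    queries [(i, None)] record the length, the others the Dedekind cuts of the
    entries. *)
Definition seq_code (s : seq (R * R)) (m : nat) : bool :=
  match unpickle m : option (nat * option (bool * rat)) with
  | Some (i, None) => (i < size s)%N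
  | Some (i, Some (b, q)) =>
      cut (if b then (nth (0, 0) s i).1 else (nth (0, 0) s i).2) q
  | None => false
  end.

Lemma seq_code_inj : injective seq_code.
Proof.
move=> s t e.
have {e} E (d : nat * option (bool * rat)) :
  seq_code s (pickle d) = seq_code t (pickle d) by rewrite e.
have lt i : (i < size s)%N = (i < size t)%N.
  by have := E (i, None); rewrite /seq_code !pickleK.
have sz : size s = size t.
  by apply/eqP; rewrite eqn_leq leqNgt lt ltnn /= leqNgt -lt ltnn.
apply: (@eq_from_nth _ (0, 0)) => // i _.
have cutE b q := E (i, Some (b, q)).
rewrite [LHS]surjective_pairing [RHS]surjective_pairing.
congr pair; apply: cut_inj => q.
  by have := cutE true q; rewrite /seq_code !pickleK.
by have := cutE false q; rewrite /seq_code !pickleK.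
Qed.

Lemma difference_operators_card :
  [set D : (R -> R) -> (R -> R) | is_difference_operator D] #<= continuum.
Proof.
pose op (s : seq (R * R)) (f : R -> R) (x : R) := \sum_(p <- s) p.1 * f (x + p.2).
have /choice[s sP] D : exists s, is_difference_operator D -> D = op s.
  have [[n [a [b Dab]]]|nD] := pselect (is_difference_operator D).
    exists [seq (a i, b i) | i <- enum 'I_n] => _.
    by apply/funext => f; apply/funext => x; rewrite Dab /op big_map big_enum.
  by exists [::].
apply: (@inj_on_card_le _ _ _ _ (fun D => seq_code (s D))) => //.
by move=> D E DD EE /seq_code_inj sDE; rewrite (sP D) // (sP E) // sDE.
Qed.

Lemma functional_system_card (S : set (equation R)) : is_system S ->
  (forall e1 e2, S e1 -> S e2 -> e1.1 = e2.1 -> e1 = e2) -> S #<= continuum.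
Proof.
move=> sysS funS; apply: card_le_trans difference_operators_card.
by apply: (@inj_on_card_le _ _ _ _ fst).
Qed.

(** Solvability of the two-element subsystems makes the system a partial
    function of the operator, hence of size at most the continuum; then the
    whole system is among the subsystems assumed solvable. *)
Lemma sc_property_above_continuum (F : set (R -> R)) (T : Type) (K : set T) :
  card_lt continuum K -> has_sc_property F K.
Proof.
move=> [cK nKc] S sysS subS.
have small S' : S' #<= continuum -> card_lt S' K.
  move=> S'c; split; first exact: card_le_trans S'c cK.
  by move=> KS'; apply: nKc; exact: card_le_trans KS' S'c.
apply: (subS) => //; apply/small/functional_system_card => //.
move=> e1 e2 Se1 Se2 e12.
have [||f _ sol] := subS [set e | e = e1 \/ e = e2].
- by move=> e [->|->].
- apply: small; apply: (@inj_on_card_le _ _ _ _ (fun e _ => `[< e = e1 >])) => //.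
  move=> x y xe ye /(congr1 (fun f => f 0%N)) h.
  have [xe1|xe1] := pselect (x = e1).
    by move: h; rewrite xe1 asboolT // => /esym/asboolP ->.
  case: ye h => [->|->].
    by rewrite [in RHS]asboolT // => /asboolP.
  by case: xe.
rewrite [e1]surjective_pairing [e2]surjective_pairing -(sol e1) -?(sol e2).
- by rewrite e12.
- by right.
- by left.
Qed.

End UpperBound.

(** * A system all of whose small subsystems are solvable *)

Section LowerBound.
Variable R : realType.

Definition increment (h : R) (f : R -> R) (x : R) : R := f (x + h) - f x.

Lemma increment_difference_operator h : is_difference_operator (increment h).
Proof.
exists 2%N, (fun i => if i == ord0 then 1 else -1),
  (fun i => if i == ord0 then h else 0) => f x.
by rewrite big_ord_recl big_ord1 /= mul1r mulN1r addr0.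
Qed.

Definition spike (x : R) : R := (x == 0)%:R.

Lemma darboux_of_surjective_on_itv (F : R -> R) :
  (forall a b t, a < b -> exists2 z, a < z < b & F z = t) -> is_darboux F.
Proof.
move=> Fsurj I itvI _ _ [a Ia <-] [b Ib <-] t tab.
have dense c d : I c -> I d -> c < d -> (F @` I) t.
  move=> Ic Id /(Fsurj _ _ t)[z /andP[cz zd] Fz]; exists z => //.
  by apply: (itvI c d) => //; rewrite !ltW.
have [ab|ba|ab] := ltrgtP a b; [exact: dense ab|exact: dense ba|].
by exists a => //; apply/eqP; rewrite eq_le; move: tab; rewrite -ab.
Qed.

Lemma spike_plus_constant_not_darboux (F : R -> R) :
  (forall h x, F (x + h) - F x = spike (x + h) - spike x) -> ~ is_darboux F.
Proof.
move=> Fspike Fdarboux.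
have Fx x : x != 0 -> F x = F 0 - 1.
  move=> x0; have := Fspike x 0; rewrite add0r /spike eqxx (negbTE x0) mulr0n mulr1n.
  by move=> e; lra.
have [] := Fdarboux setT _ (F 1) (F 0) _ _ (F 0 - 1 / 2).
- by [].
- by exists 1.
- by exists 0.
- by rewrite Fx ?oner_eq0 //; apply/andP; split; lra.
- by move=> x _; have [->|/Fx ->] := eqVneq x 0; lra.
Qed.

(** The periodic summand is constant on each coset v y + V, where it takes the
    real coded by y, and these reals exhaust R. Each coset is dense, so every
    open interval contains a point with any prescribed value; the point is
    chosen different from 0, where [spike] does not vanish. *)
Lemma spike_plus_periodic_darboux (V : set R) (v : (nat -> bool) -> R) :
  qsubspace V -> (exists2 g, V g & g != 0) ->
  (forall y y', V (v y - v y') -> y = y') ->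
  exists2 F : R -> R, is_darboux F &
    forall h, V h -> increment h F = increment h spike.
Proof.
move=> qV [g Vg g0] vinj.
have [V0 VN VD VZ] := sub_closed_ops qV.1 Vg.
pose dec (y : nat -> bool) : R :=
  xget 0 [set r | forall q, cut r q = y (pickle q)].
have decK (t : R) : exists y, dec y = t.
  exists (fun m => if unpickle m is Some q then cut t q else false).
  apply: xget_unique => [q|r rt]; first by rewrite pickleK.
  by apply: cut_inj => q; rewrite rt pickleK.
have /choice[phi phiE] z : exists r : R,
    (forall y, V (z - v y) -> r = dec y) /\ ((forall y, ~ V (z - v y)) -> r = 0).
  have [[y Vy]|nV] := pselect (exists y, V (z - v y)).
    exists (dec y); split=> [y' Vy'|/(_ y)//]; congr dec; apply: vinj.
    by rewrite (_ : _ - _ = (z - v y') - (z - v y)); [exact: qV.1|ring].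
  by exists 0; split=> // y Vy; case: nV; exists y.
have phi_coset y z : V (z - v y) -> phi z = dec y by exact: (phiE z).1.
have phi_out z : (forall y, ~ V (z - v y)) -> phi z = 0 := (phiE z).2.
have phi_periodic h z : V h -> phi (z + h) = phi z.
  move=> Vh; have [[y Vy]|nV] := pselect (exists y, V (z - v y)).
    by rewrite (phi_coset y) ?(phi_coset y z) // addrAC; exact: VD.
  rewrite !phi_out // => y Vy; apply: nV; exists y => //.
  by rewrite (_ : _ - _ = (z + h - v y) - h); [exact: qV.1|ring].
exists (fun z => spike z + phi z); last first.
  move=> h Vh; apply/funext => x; rewrite /increment phi_periodic //; ring.
apply: darboux_of_surjective_on_itv => a b t ab; have [y <-] := decK t.
(* Shrink the interval to one not containing 0. *)
have [c [d [cd ac db cd0]]] : exists c d, [/\ c < d, a <= c, d <= b & 0 <= c \/ d <= 0].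
  have [b0|b0] := leP b 0; first by exists a, b; split=> //; right.
  exists (Num.max a 0), b; split=> //; first by rewrite gt_max ab.
    by rewrite le_max lexx.
  by left; rewrite le_max lexx orbT.
have [|z Vz /andP[cz zd]] := qsubspace_dense (a := c - v y) (b := d - v y) qV Vg g0.
  by rewrite ltrD2r.
have {}cz : c < z + v y by rewrite -ltrBlDr.
have {}zd : z + v y < d by rewrite -ltrBrDr.
exists (z + v y); first by rewrite (le_lt_trans ac) // (lt_le_trans zd).
rewrite (phi_coset y) ?addrK // /spike.
suff /negbTE-> : z + v y != 0 by rewrite add0r.
case: cd0 => [c0|d0]; first by rewrite gt_eqF // (le_lt_trans c0).
by rewrite lt_eqF // (lt_le_trans zd).
Qed.

(** A subsystem that is too small to admit an embedding of L cannot map onto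
    2^omega when L is at most the continuum, so its equations miss some index x
    as exceptional index and all their steps lie in G x. The full system pins
    down the solution up to a constant. *)
Lemma no_sc_property_below_continuum (T : Type) (L : set T) :
  L #<= continuum -> ~ has_sc_property [set f : R -> R | is_darboux f] L.
Proof.
move=> Lc scL.
have [G [v [qG G0 vinj Ggen]]] := separating_subspaces R.
pose H x : set R := [set h | forall x', x' <> x -> G x' h].
pose spike_eq h : equation R := (increment h, increment h spike).
pose S : set (equation R) := [set e | exists x h, H x h /\ e = spike_eq h].
have sysS : is_system S.
  by move=> _ [x [h [_ ->]]]; exact: increment_difference_operator.
have [S' S'S [S'L nLS']|F /= Fdarboux Fsol] := scL S sysS.
  (* An exceptional index for the step of each equation of the subsystem. *)
  have /choice[m mP] e :
      exists x, S' e -> exists h, H x h /\ e = spike_eq h.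
    have [/S'S[x ex]|nS'e] := pselect (S' e).
      by exists x.
    by exists xpredT.
  have [x nx] : exists x, forall e, S' e -> x <> m e.
    apply: contrapT => all; apply: nLS'; apply: card_le_trans Lc _.
    apply: card_le_trans (card_image_le m S'); apply: subset_card_le => x _.
    apply: contrapT => nx; apply: all; exists x => e S'e xme.
    by apply: nx; exists e.
  have [F Fdarboux Fper] := spike_plus_periodic_darboux (qG x) (G0 x) (@vinj x).
  exists F => // e S'e; have [h [Hh ->]] := mP e S'e.
  by apply: Fper; apply: Hh; exact: nx.
apply: spike_plus_constant_not_darboux Fdarboux => h.
apply: (Ggen [set h | forall x, F (x + h) - F x = spike (x + h) - spike x]).
  move=> a b Fa Fb x; have := Fa (x - b); have := Fb (x - b).
  rewrite subrK (_ : x - b + a = x + (a - b)); last by ring.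
  by move=> h1 h2; lra.
move=> {}h x Hh y.
have Sh : S (spike_eq h) by exists x, h.
by have /(congr1 (fun f => f y)) := Fsol _ Sh.
Qed.

End LowerBound.

Theorem theorem4p1 (R : realType) :
  exists (T : Type) (K : set T),
    is_successor_cardinal continuum K /\
    is_solvability_cardinal [set f : R -> R | is_darboux f] K.
Proof.
have [T [K [succK leastK]]] := successor_cardinal_exists continuum.
exists T, K; split=> //; split; first exact: sc_property_above_continuum succK.1.
move=> U L scL; apply: leastK => Lc; exact: no_sc_property_below_continuum Lc scL.
Qed.
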